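(* Let $A$ be a finite set of cardinality $|A|=k\ge 2$, and let $\mathcal{D}$ be the clone on $A$ generated by the discriminator function on $A$. For $d=k^k-k^{k-1}+1$, every operation on $A$ is $\mathcal{D}$-equivalent to a $d$-ary operation on $A$.
   Context: For a nonempty set $A$ and an integer $n\ge1$, an $n$-ary operation on $A$ is a function $A^n\to A$; $\mathcal{O}_A^{(n)}$ is the set of all $n$-ary operations and $\mathcal{O}_A=\bigcup_{n\ge1}\mathcal{O}_A^{(n)}$. The projections are $p_i^{(n)}(a_1,\dots,a_n)=a_i$ ($1\le i\le n$). An $m$-tuple $\mathbf{h}=(h_1,\dots,h_m)$ of $n$-ary operations is identified with the function $\mathbf{h}\colon A^n\to A^m$, and for $g\in\mathcal{O}_A^{(m)}$, $g\circ\mathbf{h}=g(h_1,\dots,h_m)\in\mathcal{O}_A^{(n)}$. A clone on $A$ is a set $\mathcal{C}\subseteq\mathcal{O}_A$ containing all projections and closed under composition: $g\circ\mathbf{h}\in\mathcal{C}$ whenever $g\in\mathcal{C}$ is $m$-ary and $\mathbf{h}$ is an $m$-tuple of $n$-ary members of $\mathcal{C}$. The clone generated by a set of operations is the smallest clone containing it. $\mathcal{C}^{(n)}$ is the set of $n$-ary members of $\mathcal{C}$. For a clone $\mathcal{C}$ on $A$, $f\in\mathcal{O}_A^{(n)}$ and $g\in\mathcal{O}_A^{(m)}$: $f$ is a $\mathcal{C}$-minor of $g$, written $f\leq_{\mathcal{C}}g$, if $f=g\circ\mathbf{h}$ for some $\mathbf{h}\in(\mathcal{C}^{(n)})^m$;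 $f$ and $g$ are $\mathcal{C}$-equivalent, written $f\equiv_{\mathcal{C}}g$, if $f\leq_{\mathcal{C}}g$ and $g\leq_{\mathcal{C}}f$. The discriminator function on $A$ is the ternary operation $t$ with $t(x,y,z)=z$ if $x=y$ and $t(x,y,z)=x$ otherwise. *)

(* Defs.v *)
From mathcomp Require Import all_boot.

Set Implicit Arguments.
Unset Strict Implicit.
Unset Printing Implicit Defensive.

(* n-ary operations on A.  Clones only contain operations of positive arity;
   [op A 0] exists as a type, so positivity of arities is required explicitly
   wherever an arity is quantified over. *)
Definition op (A : finType) (n : nat) := {ffun n.-tuple A -> A}.

Definition opset (A : finType) := forall n : nat, op A n -> Prop.

Definition proj (A : finType) (n : nat) (i : 'I_n) : op A n :=
  [ffun a : n.-tuple A => tnth a i].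

Definition comp (A : finType) (m n : nat) (g : op A m)
    (h : m.-tuple (op A n)) : op A n :=
  [ffun a : n.-tuple A => g [tuple tnth h i a | i < m]].

(* In [clone_proj], the existence of [i : 'I_n] forces [0 < n]. *)
Record is_clone (A : finType) (C : opset A) : Prop := IsClone {
  clone_proj : forall (n : nat) (i : 'I_n), C n (proj A i);
  clone_comp : forall (m n : nat) (g : op A m) (h : m.-tuple (op A n)),
    0 < m -> 0 < n -> C m g -> (forall i : 'I_m, C n (tnth h i)) ->
    C n (comp g h)
}.

(* The intersection of all clones containing F. *)
Definition clone_generated (A : finType) (F : opset A) : opset A :=
  fun n f => forall C : opset A, is_clone C ->
    (forall (m : nat) (g : op A m), 0 < m -> F m g -> C m g) -> C n f.

Inductive opset1 (A : finType) (m : nat) (g : op A m) :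
    forall n : nat, op A n -> Prop :=
  Opset1 : opset1 g g.

Definition minor (A : finType) (C : opset A) (n m : nat)
    (f : op A n) (g : op A m) : Prop :=
  exists h : m.-tuple (op A n), (forall i : 'I_m, C n (tnth h i)) /\
    f = comp g h.

Definition clone_equiv (A : finType) (C : opset A) (n m : nat)
    (f : op A n) (g : op A m) : Prop :=
  minor C f g /\ minor C g f.

Definition discriminator (A : finType) : op A 3 :=
  [ffun a : 3.-tuple A =>
    if [tnth a 0] == [tnth a 1] then [tnth a 2] else [tnth a 0]].

Definition discriminator_clone (A : finType) : opset A :=
  clone_generated (opset1 (discriminator A)).
Arguments discriminator_clone A : clear implicits.

(* Main.v *)
Require Import Defs.
From mathcomp Require Import all_boot all_fingroup zify.

Set Implicit Arguments.
Unset Strict Implicit.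
Unset Printing Implicit Defensive.

(** The clone D of the discriminator t contains every operation that selects
one of its arguments according to which of the arguments are equal
([clone_pattern]): from t one builds the switching operation (if x = y then z
else w), and a decision tree of switches reads off the whole equality pattern.
Two tuples have the same pattern exactly when a permutation p of A carries one
to the other ([pattern_relabelP]).  Hence f is a D-minor of g as soon as each
tuple a admits one index map s with f(p a) = g((p a) o s) for all permutations
p ([minor_relabel]).

So all that matters about an argument a of f is its profile: its set of
entries together with the function p |-> f(p a), both considered up to
replacing a by r a for a permutation r of A ([same_profile]).  Let Z assign to each n-tuple a a d-tuple with equally many distinct entries, in such
a way that tuples with different profiles get different patterns.  A d-ary g
is then defined by reading the pattern of its argument and letting f act on
the n-tuple extracted from it, so that every profile of f reappears in g and g
is equivalent to f ([equiv_of_encoding]).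

The existence of Z is a matter of counting, separately for each number r of
distinct entries.  For r = 1 there is one profile.  For r >= 2 at least
2^(d+1-r) - 1 patterns of d-tuples have r blocks: list the r values except the
second one and fill the d+1-r remaining places by an arbitrary word in the
first two values that uses the second ([patterns_of_rank]).  There are at most
k^(k!) profiles, and k! < k^(k-1) makes this small enough for k >= 3
([profiles_le_patterns]).  For k = 2 and d = 3 this count fails, as there are
4 functions but only 3 patterns; but exchanging the two elements of A
identifies two of the functions ([profile_key_card2]). *)

(** * Patterns of tuples and permutations of the alphabet *)

Section Tuples.
Variable A : finType.

(** The action of the permutations of [A] on tuples, entry by entry. *)
Definition relabel n (p : {perm A}) (a : n.-tuple A) : n.-tuple A :=
  [tuple of map p a].

(** The tuple [a o s], with tuples seen as functions on indices. *)
Definition select m n (a : n.-tuple A) (s : {ffun 'I_m -> 'I_n}) : m.-tuple A :=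
  [tuple tnth a (s i) | i < m].

(** The equality pattern of [a]: the truth values of [a_i = a_j], listed in the
order in which the pairs of indices are enumerated. *)
Definition pattern n (a : n.-tuple A) : seq bool :=
  [seq tnth a p.1 == tnth a p.2 | p <- enum {: 'I_n * 'I_n}].

(** The number of distinct entries. *)
Definition rank (s : seq A) : nat := size (undup s).

Lemma relabelM n (p q : {perm A}) (a : n.-tuple A) :
  relabel p (relabel q a) = relabel (q * p)%g a.
Proof. by apply: eq_from_tnth => i; rewrite !tnth_map permM. Qed.

Lemma relabel1 n (a : n.-tuple A) : relabel 1%g a = a.
Proof. by apply: eq_from_tnth => i; rewrite tnth_map perm1. Qed.

Lemma select_relabel m n (p : {perm A}) (a : n.-tuple A)
    (s : {ffun 'I_m -> 'I_n}) :
  select (relabel p a) s = relabel p (select a s).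
Proof. by apply: eq_from_tnth => i; rewrite !(tnth_map, tnth_ord_tuple). Qed.

Lemma select_sub m n (a : n.-tuple A) (s : {ffun 'I_m -> 'I_n}) :
  {subset select a s <= a}.
Proof. by move=> x /mapP[i _ ->]; exact: mem_tnth. Qed.

Lemma select_of_sub m n (x : m.-tuple A) (a : n.-tuple A) :
  {subset x <= a} -> exists s : {ffun 'I_m -> 'I_n}, x = select a s.
Proof.
move=> sxa.
have /fin_all_exists[s sP] (i : 'I_m) : exists j, tnth x i = tnth a j.
  by apply/tnthP/sxa/mem_tnth.
exists (finfun s); apply: eq_from_tnth => i.
by rewrite tnth_map tnth_ord_tuple ffunE.
Qed.

Lemma pattern_eqP n (a b : n.-tuple A) :
  pattern a = pattern b <->
  forall i j, (tnth a i == tnth a j) = (tnth b i == tnth b j).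
Proof.
split=> [/eq_in_map eq_ab i j | eq_ab].
  by apply: (eq_ab (i, j)); rewrite mem_enum.
by apply: eq_map => p; apply: eq_ab.
Qed.

Lemma pattern_relabel n (p : {perm A}) (a : n.-tuple A) :
  pattern (relabel p a) = pattern a.
Proof.
by apply/pattern_eqP => i j; rewrite !tnth_map (inj_eq perm_inj).
Qed.

Lemma rank_relabel n (p : {perm A}) (a : n.-tuple A) :
  rank (relabel p a) = rank a.
Proof. by rewrite /rank undup_map_inj ?size_map //; exact: perm_inj. Qed.

Lemma rank_uniq (s t : seq A) : uniq t -> s =i t -> rank s = size t.
Proof.
move=> t_uniq eq_st; apply/perm_size/uniq_perm => // [|x].
  exact: undup_uniq.
by rewrite mem_undup.
Qed.

(** A partial injection of a finite set extends to a permutation of it. *)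
Lemma perm_extends (s t : seq A) :
  uniq s -> uniq t -> size s = size t ->
  exists p : {perm A}, map p s = t.
Proof.
move=> s_uniq t_uniq eq_st.
(* Both sequences are completed to enumerations of A, matched by position. *)
pose full (r : seq A) := r ++ [seq x <- enum A | x \notin r].
have full_mem r x : x \in full r.
  by rewrite mem_cat mem_filter mem_enum andbT orbN.
have full_uniq r : uniq r -> uniq (full r).
  move=> r_uniq; rewrite cat_uniq r_uniq filter_uniq ?enum_uniq // andbT /=.
  by apply/hasPn => x; rewrite mem_filter => /andP[].
have full_size r : uniq r -> size (full r) = #|A|.
  move=> /full_uniq r_uniq; rewrite cardE; apply/perm_size/uniq_perm => //.
    exact: enum_uniq.
  by move=> x; rewrite full_mem mem_enum.
pose q x := nth x (full t) (index x (full s)).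
have idx x : index x (full s) < size (full t).
  by rewrite full_size // -(full_size s) // index_mem.
have q_inj : injective q.
  move=> x y; rewrite /q (set_nth_default x y) // => /eqP.
  rewrite nth_uniq ?full_uniq // => /eqP /(congr1 (nth x (full s))).
  by rewrite !nth_index.
exists (perm q_inj).
case: (posnP (size s)) => [s_nil|s_gt0].
  move: eq_st; rewrite s_nil => /esym/size0nil ->.
  by rewrite (size0nil s_nil).
have x0 : A := tnth (in_tuple s) (Ordinal s_gt0).
apply: (@eq_from_nth _ x0); rewrite size_map // => i i_lt.
rewrite (nth_map x0) // permE /q index_cat mem_nth // index_uniq //.
(* The default values differ, but the index is in range. *)
by rewrite nth_cat -eq_st i_lt; apply: set_nth_default; rewrite -eq_st.
Qed.

Lemma pattern_relabelP n (a b : n.-tuple A) :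
  pattern a = pattern b -> exists p : {perm A}, b = relabel p a.
Proof.
move=> /pattern_eqP eq_ab.
have /fin_all_exists[phi phiP] (x : A) :
    exists y, forall i, tnth a i = x -> tnth b i = y.
  have [/tnthP[i ->]|x_a] := boolP (x \in a).
    by exists (tnth b i) => j /eqP; rewrite eq_ab => /eqP.
  by exists x => i eq_x; rewrite -eq_x mem_tnth in x_a.
have phi_inj : {in undup a &, injective phi}.
  move=> x y; rewrite !mem_undup => /tnthP[i ->] /tnthP[j ->].
  by rewrite -!(phiP _ _ erefl) => /eqP; rewrite -eq_ab => /eqP.
have [|||p pP] := @perm_extends (undup a) (map phi (undup a)).
- exact: undup_uniq.
- by rewrite map_inj_in_uniq ?undup_uniq.
- by rewrite size_map.
exists p; apply: eq_from_tnth => i; rewrite tnth_map (phiP _ _ erefl).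
have /eq_in_map -> // := esym pP.
by rewrite mem_undup mem_tnth.
Qed.

Lemma rank_relabelP n (a : n.-tuple A) (t : seq A) :
  rank a = rank t -> exists p : {perm A}, relabel p a =i t.
Proof.
move=> eq_r.
have [p pP] := perm_extends (undup_uniq a) (undup_uniq t) eq_r.
exists p => x; rewrite -(mem_undup t) -pP.
by apply/mapP/mapP => -[y y_in ->]; exists y; rewrite ?mem_undup // in y_in *.
Qed.

Lemma rank_sub_eq (s t : seq A) :
  {subset s <= t} -> rank s = rank t -> s =i t.
Proof.
move=> s_st eq_r x; rewrite -(mem_undup s) -(mem_undup t).
apply: (uniq_min_size (undup_uniq s) _ _).2; last by rewrite -/(rank t) -eq_r.
by move=> y; rewrite !mem_undup; exact: s_st.
Qed.

Lemma rank_gt0 n (a : n.-tuple A) : 0 < n -> 0 < rank a.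
Proof.
move=> n_gt0; rewrite lt0n size_eq0; apply/eqP => a_nil.
by have := mem_tnth (Ordinal n_gt0) a; rewrite -mem_undup a_nil.
Qed.

Lemma rank_le_card (s : seq A) : rank s <= #|A|.
Proof. by rewrite /rank -(card_uniqP (undup_uniq s)) max_card. Qed.

Lemma rank1_eq (s t : seq A) : rank s = 1 -> size s = size t -> s =i t -> s = t.
Proof.
rewrite /rank => r1 eq_sz eq_st.
have [x us] : exists x, undup s = [:: x].
  by case: (undup s) r1 => [|x []] // _; exists x.
have const (u : seq A) : u =i s -> u = nseq (size u) x.
  move=> eq_us; apply/all_pred1P/allP => y.
  by rewrite eq_us -mem_undup us inE.
by rewrite (const s) // (const t) ?eq_sz.
Qed.

End Tuples.

(** * Minors over the discriminator clone *)

Lemma clone_discriminator (A : finType) (C : opset A) n (u v w : op A n) :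
  is_clone C -> C 3 (discriminator A) -> 0 < n ->
  C n u -> C n v -> C n w ->
  C n [ffun a => if u a == v a then w a else u a].
Proof.
move=> C_clone C_disc n_gt0 Cu Cv Cw.
have -> : [ffun a => if u a == v a then w a else u a] =
          Defs.comp (discriminator A) [tuple u; v; w].
  by apply/ffunP => a; rewrite !ffunE !tnth_map !tnth_ord_tuple.
by apply: (clone_comp C_clone) => // -[[|[|[|//]]] i_lt]; rewrite (tnth_nth u).
Qed.

(** The switching operation is [t (t x y z) (t x y w) w]. *)
Lemma clone_switch (A : finType) (C : opset A) n (i j : 'I_n) (u v : op A n) :
  is_clone C -> C 3 (discriminator A) -> C n u -> C n v ->
  C n [ffun a : n.-tuple A => if tnth a i == tnth a j then u a else v a].
Proof.
move=> C_clone C_disc Cu Cv; have n_gt0 : 0 < n by case: (n) i => [[]|].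
have Cp := clone_proj C_clone.
have := clone_discriminator C_clone C_disc n_gt0
  (clone_discriminator C_clone C_disc n_gt0 (Cp _ i) (Cp _ j) Cu)
  (clone_discriminator C_clone C_disc n_gt0 (Cp _ i) (Cp _ j) Cv) Cv.
congr (C _ _); apply/ffunP => a; rewrite !ffunE.
by case: (tnth a i == tnth a j); [case: eqP | rewrite eqxx].
Qed.

(** An operation that selects an argument according to the equality pattern is
a decision tree: each equality test in the pattern is one switch, and the
leaves are projections. *)
Lemma clone_pattern (A : finType) (C : opset A) n (c : seq bool -> 'I_n) :
  is_clone C -> C 3 (discriminator A) ->
  C n [ffun a : n.-tuple A => tnth a (c (pattern a))].
Proof.
move=> C_clone C_disc; rewrite /pattern; elim: (enum _) c => [|p s IHs] c /=.
  by have := clone_proj C_clone (c [::]).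
have := clone_switch p.1 p.2 C_clone C_disc
  (IHs (c \o cons true)) (IHs (c \o cons false)).
by congr (C _ _); apply/ffunP => a; rewrite !ffunE; case: eqP.
Qed.

(** Sufficient condition for being a minor: the index map [s] may depend on
[a], but it has to serve the whole orbit of [a].  The orbit is determined by
the pattern, so [s] can be chosen as a function of the pattern alone. *)
Lemma minor_relabel (A : finType) n m (f : op A n) (g : op A m) : 0 < n ->
  (forall a, exists s : {ffun 'I_m -> 'I_n}, forall p : {perm A},
     f (relabel p a) = g (select (relabel p a) s)) ->
  minor (discriminator_clone A) f g.
Proof.
move=> n_gt0 fg.
(* The index map s is right for all tuples of pattern b. *)
pose good (b : seq bool) (s : {ffun 'I_m -> 'I_n}) :=
  [forall a : n.-tuple A, (pattern a == b) ==> (f a == g (select a s))].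
have good_ex (a : n.-tuple A) : exists s, good (pattern a) s.
  have [s sP] := fg a; exists s; apply/forallP => a'.
  apply/implyP => /eqP/esym /pattern_relabelP[p ->]; exact/eqP.
pose c b := odflt [ffun=> Ordinal n_gt0] [pick s | good b s].
have cP (a : n.-tuple A) : f a = g (select a (c (pattern a))).
  rewrite /c; case: pickP => [s /forallP/(_ a)|no_s].
    by rewrite eqxx => /eqP.
  by have [s] := good_ex a; rewrite no_s.
exists [tuple [ffun a : n.-tuple A => tnth a (c (pattern a) i)] | i < m].
split=> [i|]; last first.
  apply/ffunP => a; rewrite ffunE cP; congr (g _).
  by apply: eq_from_tnth => i; rewrite !tnth_mktuple ffunE.
rewrite tnth_mktuple => C C_clone C_disc.
by apply: (clone_pattern (fun b => c b i) C_clone); exact: C_disc.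
Qed.

(** Up to a permutation [r] of [A] applied to [a'], the tuples [a] and [a'] have
the same set of entries and the same function [p |-> f (p a)]. *)
Definition same_profile (A : finType) n (f : op A n) (a a' : n.-tuple A) :=
  exists r : {perm A}, a =i relabel r a' /\
  forall p, f (relabel p a) = f (relabel p (relabel r a')).

(** * Equivalence from an encoding of profiles by patterns *)

(** The operation [g] reads the pattern of its argument [x]; the pattern
determines an index map [s], and [g x = f (x o s)].  This is a minor of [f]
for any choice of [s], and the encoding [Z] dictates a choice for which [f] is
a minor of [g]. *)
Lemma equiv_of_encoding (A : finType) n d (f : op A n)
    (Z : n.-tuple A -> d.-tuple A) : 0 < n -> 0 < d ->
  (forall a : n.-tuple A, rank (Z a) = rank a) ->
  (forall a a', pattern (Z a) = pattern (Z a') -> same_profile f a a') ->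
  exists g : op A d, clone_equiv (discriminator_clone A) f g.
Proof.
move=> n_gt0 d_gt0 rankZ profZ.
(* From some Z a of pattern b, the index map s extracts a copy of a. *)
pose good (b : seq bool) (s : {ffun 'I_n -> 'I_d}) :=
  [exists a : n.-tuple A, (pattern (Z a) == b) &&
    [exists r : {perm A}, relabel r a == select (Z a) s]].
have good_ex (a : n.-tuple A) : exists s, good (pattern (Z a)) s.
  have [r eq_r] := rank_relabelP (esym (rankZ a)).
  have [|s sP] := @select_of_sub _ _ _ (relabel r a) (Z a).
    by move=> x; rewrite eq_r.
  exists s; apply/existsP; exists a; rewrite eqxx; apply/existsP; exists r.
  exact/eqP.
pose c b := odflt [ffun=> Ordinal d_gt0] [pick s | good b s].
exists [ffun x => f (select x (c (pattern x)))]; split; last first.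
  apply: minor_relabel => // x; exists (c (pattern x)) => p.
  by rewrite ffunE pattern_relabel.
apply: minor_relabel => // a.
have : good (pattern (Z a)) (c (pattern (Z a))).
  rewrite /c; case: pickP => [//|no_s].
  by have [s] := good_ex a; rewrite no_s.
set s := c _ => /existsP[a' /andP[/eqP eq_pat /existsP[q /eqP qP]]].
have [r [im_r f_r]] := profZ _ _ (esym eq_pat).
(* The argument at which g reproduces the profile of a. *)
pose x := relabel (q^-1 * r)%g (Z a').
have xs : select x s = relabel r a'.
  by rewrite select_relabel -qP relabelM mulgA mulgV mul1g.
have pat_x : pattern x = pattern (Z a) by rewrite pattern_relabel.
have im_x : a =i x.
  move=> y; rewrite im_r -xs; apply: rank_sub_eq; first exact: select_sub.
  by rewrite xs !rank_relabel rankZ.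
have [|t tP] := @select_of_sub _ _ _ x a; first by move=> y; rewrite im_x.
exists t => p; rewrite f_r select_relabel -tP ffunE pattern_relabel pat_x -/s.
by rewrite select_relabel xs.
Qed.

(** * Counting patterns and profiles *)

(** A lower bound on the number of patterns of [d]-tuples with exactly [r]
distinct entries, for [0 < r <= d]. *)
Definition npatterns d r := if r == 1 then 1 else (2 ^ (d.+1 - r)).-1.

(** With [e] enumerating [A], the patterns for [r >= 2] are those of the tuples
[e 0, e 2, ..., e (r - 1)] followed by a word in [e 0] and [e 1] in which [e 1]
occurs.  The word is recovered from the pattern by comparing its letters with
the first entry. *)
Lemma patterns_of_rank (A : finType) d r : 0 < r -> r <= #|A| -> r <= d ->
  exists y : nat -> d.-tuple A, (forall j, rank (y j) = r) /\
    {in [pred j | j < npatterns d r] &, injective (fun j => pattern (y j))}.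
Proof.
move=> r_gt0 r_leA r_led.
have [x0 _] : exists x : A, x \in A by apply/card_gt0P; exact: leq_trans r_leA.
pose e i := nth x0 (enum A) i.
have e_lt i : i < r -> i < size (enum A).
  by move=> i_lt; rewrite -cardE; exact: leq_trans r_leA.
have e_uniq : uniq (map e (iota 0 r)).
  rewrite map_inj_in_uniq ?iota_uniq // => i j.
  rewrite !mem_iota /= => i_lt j_lt.
  by move=> /eqP; rewrite nth_uniq ?enum_uniq ?e_lt // => /eqP.
have [r1|r_neq1] := eqVneq r 1.
  exists (fun _ => [tuple of nseq d x0]); split=> [_|i j].
    rewrite (@rank_uniq _ _ [:: x0]) // => x; rewrite mem_nseq inE.
    by rewrite (leq_trans r_gt0 r_led).
  by rewrite !inE /npatterns r1 eqxx; lia.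
have e01 : e 1 != e 0.
  have : uniq (map e (iota 0 2)).
    apply: subseq_uniq e_uniq; apply: map_subseq.
    by rewrite -(subnKC (_ : 2 <= r)) ?iotaD ?prefix_subseq //; lia.
  by rewrite /= inE andbT eq_sym.
pose m := d.+1 - r.
pose tail (u : seq bool) := [seq if b then e 1 else e 0 | b <- u].
pose s u := e 0 :: map e (iota 2 (r - 2)) ++ tail u.
have s_size (u : m.-tuple bool) : size (s u) == d.
  by rewrite /= size_cat !size_map size_iota size_tuple /m; apply/eqP; lia.
pose Y u := Tuple (s_size u).
pose us := enum (predC1 [tuple of nseq m false]).
have us_size : size us = npatterns d r.
  by rewrite -cardE cardC1 card_tuple card_bool /npatterns (negbTE r_neq1).
have Y_rank u : u \in us -> rank (Y u) = r.
  rewrite mem_enum inE /= => u_nz.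
  rewrite (rank_uniq e_uniq) ?size_map ?size_iota // => x.
  have u_true : true \in u.
    apply: contraR u_nz => u_false; apply/eqP/val_inj => /=.
    have /all_pred1P -> : all (pred1 false) u; last by rewrite size_tuple.
    by apply/allP => -[] // u_true; rewrite u_true in u_false.
  have -> : iota 0 r = [:: 0, 1 & iota 2 (r - 2)].
    by rewrite -{1}(subnKC (_ : 2 <= r)) //; lia.
  rewrite /= !inE mem_cat; have [//|x_neq0] := eqVneq x (e 0).
  rewrite /= orbC; congr (_ || _); apply/mapP/eqP => [[[] _ // eq_x]|->].
    by rewrite eq_x eqxx in x_neq0.
  by exists true.
have Y_inj : injective (fun u => pattern (Y u)).
  move=> u v /pattern_eqP eq_uv; apply: eq_from_tnth => l.
  have tail_nth (w : m.-tuple bool) :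
      nth x0 (s w) (r.-1 + l) = if tnth w l then e 1 else e 0.
    have -> : r.-1 + l = (r - 2 + l).+1 by lia.
    rewrite /= nth_cat size_map size_iota ltnNge leq_addr /= addKn.
    by rewrite (nth_map false) ?size_tuple // -tnth_nth.
  have d_gt0 : 0 < d by lia.
  have l_lt : r.-1 + l < d by have := ltn_ord l; rewrite /m; lia.
  have := eq_uv (Ordinal d_gt0) (Ordinal l_lt).
  rewrite !(tnth_nth x0) !tail_nth.
  by case: (tnth u l); case: (tnth v l); rewrite //= eqxx eq_sym (negbTE e01).
have us_gt0 : 0 < size us.
  rewrite us_size /npatterns (negbTE r_neq1) -ltnS prednK ?expn_gt0 //.
  by rewrite -{1}(expn0 2) ltn_exp2l //; lia.
(* The default value is the first word, so that all values have rank r. *)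
exists (fun j => Y (nth (nth [tuple of nseq m false] us 0) us j)).
split=> [j|i j].
  apply: Y_rank; have [j_lt|j_ge] := ltnP j (size us); first exact: mem_nth.
  by rewrite nth_default // mem_nth.
rewrite !inE -us_size => i_lt j_lt /Y_inj/eqP.
by rewrite nth_uniq ?enum_uniq // => /eqP.
Qed.

(** It is enough to number the profiles, separately for each rank at least 2,
by numbers below [npatterns d r]. *)
Lemma equiv_of_key (A : finType) n d (f : op A n) (key : n.-tuple A -> nat) :
  0 < n -> 0 < #|A| <= d ->
  (forall a : n.-tuple A, 1 < rank a -> key a < npatterns d (rank a)) ->
  (forall a a' : n.-tuple A, 1 < rank a -> rank a = rank a' -> key a = key a' ->
     same_profile f a a') ->
  exists g : op A d, clone_equiv (discriminator_clone A) f g.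
Proof.
move=> n_gt0 /andP[A_gt0 leAd] key_lt key_prof.
have rank_pos (a : n.-tuple A) := rank_gt0 a n_gt0.
have /fin_all_exists[y yP] (i : 'I_#|A|) := @patterns_of_rank A d i.+1
  (ltn0Sn i) (ltn_ord i) (leq_trans (ltn_ord i) leAd).
have rank_lt (a : n.-tuple A) : (rank a).-1 < #|A|.
  by rewrite prednK ?rank_le_card.
pose ix (a : n.-tuple A) := Ordinal (rank_lt a).
have ixE (a : n.-tuple A) : (ix a).+1 = rank a by rewrite /= prednK.
pose key' (a : n.-tuple A) := if rank a == 1 then 0 else key a.
(* The number of a selects a pattern whose rank is that of a. *)
pose Z a := y (ix a) (key' a).
have Z_rank (a : n.-tuple A) : rank (Z a) = rank a.
  by rewrite (yP (ix a)).1 ixE.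
apply: (@equiv_of_encoding _ _ _ f Z) => //; first exact: leq_trans leAd.
move=> a a' eq_pat.
have eq_rank : rank a = rank a'.
  have [p Zp] := pattern_relabelP eq_pat.
  by rewrite -Z_rank -[RHS]Z_rank Zp rank_relabel.
have eq_ix : ix a' = ix a by apply: val_inj; rewrite /= eq_rank.
have key'_lt (b : n.-tuple A) : key' b < npatterns d (rank b).
  rewrite /key'; case: eqP => [->|/eqP b_neq1]; first by rewrite /npatterns.
  by apply: key_lt; rewrite ltn_neqAle eq_sym b_neq1 rank_pos.
have eq_key : key' a = key' a'.
  move: eq_pat; rewrite /Z eq_ix; apply: (yP (ix a)).2; rewrite inE ixE //.
  by rewrite eq_rank.
(* Any two constant tuples have the same profile. *)
have [a_eq1|a_neq1] := eqVneq (rank a) 1.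
  have [p im_p] := rank_relabelP (esym eq_rank).
  exists p; split=> [x|q]; first by rewrite im_p.
  congr (f (relabel q _)); apply: val_inj; apply: rank1_eq => //.
  by rewrite !size_tuple.
apply: (key_prof _ _ _ eq_rank).
  by rewrite ltn_neqAle eq_sym a_neq1 rank_pos.
by move: eq_key; rewrite /key' -eq_rank (negbTE a_neq1).
Qed.

Lemma fact_lt_expn k : 2 < k -> k`! < k ^ k.-1.
Proof.
elim: k => [//|k IHk]; rewrite ltnS leq_eqVlt => /predU1P[<- //|k_gt2].
have k_gt0 : 0 < k by lia.
rewrite factS -[X in _ ^ X](prednK k_gt0) expnS ltn_pmul2l //.
by apply: leq_trans (IHk k_gt2) _; rewrite leq_exp2r //; lia.
Qed.

Lemma profiles_le_patterns k r : 2 < k -> 1 < r <= k ->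
  k ^ k`! <= npatterns (k ^ k - k ^ k.-1 + 1) r.
Proof.
move=> k_gt2 /andP[r_gt1 r_le].
rewrite /npatterns gtn_eqF // -ltnS prednK ?expn_gt0 //.
have k_le : k <= 2 ^ k.-1 by have := ltn_expl k.-1 (ltnSn 1); lia.
(* By k <= 2^(k-1) and k! < k^(k-1), it remains to compare exponents of 2. *)
apply: (@leq_ltn_trans (2 ^ (k.-1 * k`!))).
  by rewrite expnM leq_exp2r ?fact_gt0.
rewrite ltn_exp2l //.
have := fact_lt_expn k_gt2.
have -> : k ^ k = k * k ^ k.-1 by rewrite -expnS prednK //; lia.
by nia.
Qed.

(** The profiles of tuples of a given rank are numbered by functions from the
permutations of [A] to [A]: each tuple is first moved so that its entries are
the first elements in the enumeration of [A]. *)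
Lemma profile_key (A : finType) n (f : op A n) :
  exists key : n.-tuple A -> 'I_(#|A| ^ #|A|`!), forall a a' : n.-tuple A,
    rank a = rank a' -> key a = key a' -> same_profile f a a'.
Proof.
have cardF : #|{ffun {perm A} -> A}| = #|A| ^ #|A|`!.
  rewrite card_ffun -cardsT -card_perm; congr (_ ^ _); apply: eq_card => p.
  by rewrite inE; apply/esym/subsetP => x _; rewrite inE.
have /fin_all_exists[c cP] (a : n.-tuple A) :
    exists p : {perm A}, relabel p a =i take (rank a) (enum A).
  apply: rank_relabelP; rewrite [RHS]/rank undup_id ?take_uniq ?enum_uniq //.
  by rewrite size_takel // -cardE rank_le_card.
pose F (a : n.-tuple A) :=
  [ffun p : {perm A} => f (relabel p (relabel (c a) a))].
exists (fun a => cast_ord cardF (enum_rank (F a))) => a a' eq_r.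
move=> /cast_ord_inj/enum_rank_inj/ffunP eq_F.
exists (c a' * (c a)^-1)%g; split=> [|p].
  rewrite -relabelM => x.
  rewrite -[in LHS](relabel1 a) -(mulgV (c a)) -relabelM.
  have im_c : relabel (c a) a =i relabel (c a') a'.
    by move=> y; rewrite !cP eq_r.
  by apply: eq_mem_map.
have := eq_F ((c a)^-1 * p)%g; rewrite !ffunE !relabelM.
by rewrite !mulgA mulgV mul1g.
Qed.

(** Over two elements with transposition [t], the profile of a nonconstant [a]
is the unordered pair of [f a] and [f (t a)], numbered by how many of the two
values equal the first element. *)
Lemma profile_key_card2 (A : finType) n (f : op A n) : #|A| = 2 ->
  exists key : n.-tuple A -> 'I_3, forall a a' : n.-tuple A,
    1 < rank a -> rank a = rank a' -> key a = key a' -> same_profile f a a'.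
Proof.
move=> cardA.
have [e0 [e1 eA]] : exists e0 e1, enum A = [:: e0; e1].
  have := cardE A; rewrite cardA.
  by case: (enum A) => [|e0 [|e1 []]] // _; exists e0, e1.
have e01 : e1 != e0 by have := enum_uniq A; rewrite eA /= inE andbT eq_sym.
have A01 x : x = e0 \/ x = e1.
  have : x \in enum A by rewrite mem_enum.
  by rewrite eA !inE => /orP[/eqP|/eqP]; [left|right].
pose t := tperm e0 e1.
have permA (p : {perm A}) : p = 1%g \/ p = t.
  have : p e0 != p e1 by rewrite (inj_eq perm_inj) eq_sym.
  case: (A01 (p e0)) (A01 (p e1)) => p0 [] p1; rewrite p0 p1 ?eqxx // => _.
    by left; apply/permP => x; rewrite perm1; case: (A01 x) => ->.
  by right; apply/permP => x; case: (A01 x) => ->; rewrite ?tpermL ?tpermR.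
have full (a : n.-tuple A) x : 1 < rank a -> x \in a.
  move=> a_gt1; rewrite (@rank_sub_eq _ a (enum A)) ?mem_enum //.
    by move=> z; rewrite mem_enum.
  rewrite [RHS]/rank undup_id ?enum_uniq // -cardE cardA.
  by apply/eqP; rewrite eqn_leq a_gt1 -cardA rank_le_card.
pose z (a : n.-tuple A) := f a == e0.
exists (fun a => inord (z a + z (relabel t a))) => a a' a_gt1 eq_r.
move=> /(congr1 val); rewrite /= !inordK; try by case: (z _); case: (z _).
have zI u v : z u = z v -> f u = f v.
  rewrite /z; case: (A01 (f u)) (A01 (f v)) => -> [] ->; rewrite ?eqxx //.
    by rewrite (negbTE e01).
  by rewrite (negbTE e01).
have tt : (t * t = 1)%g by apply: tperm2.
move=> eq_z.
have [[z0 z1]|[z0 z1]] : z a = z a' /\ z (relabel t a) = z (relabel t a') \/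
    z a = z (relabel t a') /\ z (relabel t a) = z a'.
  by move: eq_z; case: (z a); case: (z a'); case: (z _); case: (z _); auto.
  exists 1%g; split=> [x|p]; first by rewrite !full ?rank_relabel -?eq_r.
  by rewrite relabel1; case: (permA p) => ->; rewrite ?relabel1; exact: zI.
exists t; split=> [x|p]; first by rewrite !full ?rank_relabel -?eq_r.
by case: (permA p) => ->; rewrite ?relabel1 ?relabelM ?tt ?relabel1; exact: zI.
Qed.

Theorem theorem4p1 (A : finType) (k : nat) (hA : #|A| = k) (hk : 2 <= k)
    (n : nat) (hn : 0 < n) (f : op A n) :
  exists g : op A (k ^ k - k ^ k.-1 + 1),
    clone_equiv (discriminator_clone A) f g.
Proof.
have leAd : 0 < #|A| <= k ^ k - k ^ k.-1 + 1.
  have k_le : k.-1 < k ^ k.-1 by exact: ltn_expl.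
  have : k ^ k = k * k ^ k.-1 by rewrite -expnS prednK //; lia.
  by rewrite hA; nia.
move: hk; rewrite leq_eqVlt => /predU1P[k2|k_gt2].
  have [|key keyP] := @profile_key_card2 A n f; first by rewrite hA.
  apply: (@equiv_of_key _ _ _ f key) => // [a a_gt1|a a' a_gt1 eq_r /val_inj].
    have -> : rank a = 2.
      by apply/eqP; rewrite eqn_leq a_gt1 k2 -hA rank_le_card.
    by rewrite -k2; exact: ltn_ord.
  exact: keyP.
have [key keyP] := profile_key f.
apply: (@equiv_of_key _ _ _ f key) => // [a a_gt1|a a' _ eq_r /val_inj].
  apply: leq_trans (ltn_ord _) _; rewrite hA profiles_le_patterns //.
  by rewrite a_gt1 -hA rank_le_card.
exact: keyP.
Qed.
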